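(* Let $\mathcal{F}_0$ and $\mathcal{F}_1$ be filters on $\omega$ containing the Fréchet filter, and let $\mathcal{B}\subseteq\omega^\omega$ be unbounded. If $\mathcal{F}_0\oplus\mathcal{F}_1$ is $\mathcal{B}$-Canjar, then Mathias forcing $\mathbb{M}(\mathcal{F}_1)$ with respect to $\mathcal{F}_1$ forces ''$\mathcal{F}_0$ is $\mathcal{B}$-Canjar''.
   Context: Filters on $\omega$ are proper and contain the Fréchet filter (of cofinite sets). $\mathcal{B}\subseteq\omega^\omega$ is unbounded if there is no $g\in\omega^\omega$ with $f\leq^* g$ for all $f\in\mathcal{B}$, where $f\leq^* g$ means $f(n)\leq g(n)$ for all but finitely many $n$. Mathias forcing $\mathbb{M}(\mathcal{F})$ is the set of pairs $(s,A)$ with $s\in 2^{<\omega}$ and $A\in\mathcal{F}$, ordered by: $(t,B)\leq(s,A)$ iff $t$ extends $s$, $B\subseteq A$, and for each $n\geq|s|$ with $t(n)=1$ we have $n\in A$. $\mathcal{F}$ is $\mathcal{B}$-Canjar if $\mathbb{M}(\mathcal{F})$ forces that $\mathcal{B}$ is (still) unbounded. In a forcing extension, ''$\mathcal{F}_0$ is $\mathcal{B}$-Canjar'' refers to the filter generated by $\mathcal{F}_0$ in that extension. For $A,B\subseteq\omega$ let $A\oplus B=\{2n: n\in A\}\cup\{2m+1: m\in B\}$, and $\mathcal{F}_0\oplus\mathcal{F}_1=\{A\oplus B: A\in\mathcal{F}_0, B\in\mathcal{F}_1\}$ (which is again a filter). *)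

(* Defs.v *)
From mathcomp Require Import all_boot.
From mathcomp Require Import all_classical.

Set Implicit Arguments.
Unset Strict Implicit.
Unset Printing Implicit Defensive.

Local Open Scope classical_set_scope.

(** * Filters on omega and unbounded families *)

(* f <=^* g *)
Definition le_star (f g : nat -> nat) : Prop :=
  \forall n \near \oo, (f n <= g n)%N.

Definition unbounded (B : set (nat -> nat)) : Prop :=
  ~ exists g : nat -> nat, forall f, B f -> le_star f g.

Definition osum (A B : set nat) : set nat :=
  [set n.*2 | n in A] `|` [set m.*2.+1 | m in B].

Definition filter_osum (F0 F1 : set_system nat) : set_system nat :=
  [set osum A B | A in F0 & B in F1].

(** * Forcing

   A [logic] is what is needed to interpret higher-order statements about the
   natural numbers in a universe: [ltv] is its type of truth values and [lname]
   its type of names for truth values, which [lval] evaluates. A subset of a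
   type [T] in that universe is given by a name [T -> lname], and [lprop] maps a
   statement about the base universe to its truth value. There are two ways to
   form logics: [ground] is the base universe, and [extension P] is the generic
   extension of a universe by a forcing [P] of that universe. Since [P] may live
   in any universe, forcing can be iterated, and a definition over an arbitrary
   logic can be read both in the base universe and in its extensions. *)

Record logic := Logic {
  ltv : Type;
  lname : Type;
  lval : lname -> ltv;
  lprop : Prop -> ltv;
  land : ltv -> ltv -> ltv;
  limp : ltv -> ltv -> ltv;
  lall : forall T : Type, (T -> ltv) -> ltv;
  lex : forall T : Type, (T -> ltv) -> ltv }.

Arguments lval {l} _.
Arguments lprop {l} _.
Arguments land {l} _ _.
Arguments limp {l} _ _.
Arguments lall {l} T _.
Arguments lex {l} T _.

Declare Scope logic_scope.
Delimit Scope logic_scope with L.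
Bind Scope logic_scope with ltv.

Notation "a &&& b" := (land a b)
  (at level 40, left associativity) : logic_scope.
Notation "a ==>> b" := (limp a b)
  (at level 55, right associativity) : logic_scope.
Notation "\A x : T , a" := (lall T (fun x => a%L))
  (at level 200, x name, T at level 99, a at level 200) : logic_scope.
Notation "\E x : T , a" := (lex T (fun x => a%L))
  (at level 200, x name, T at level 99, a at level 200) : logic_scope.

Definition ground : logic :=
  {| ltv := Prop; lname := Prop; lval := id; lprop := id;
     land := and; limp := fun a b => a -> b;
     lall := fun T a => forall x, a x;
     lex := fun T a => exists x, a x |}.

Definition lneg (L : logic) (a : ltv L) : ltv L := (a ==>> lprop False)%L.

(* A forcing in the universe [L]. The elements of [cond] are names, and only
   those satisfying [dom] denote conditions. *)
Record forcing (L : logic) := Forcing {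
  cond : Type;
  dom : cond -> ltv L;
  below : cond -> cond -> ltv L }.

Arguments dom {L} _ _.
Arguments below {L} _ _ _.

Section Extension.
Variables (L : logic) (P : forcing L).
Local Open Scope logic_scope.

Definition all_below (p : cond P) (a : cond P -> ltv L) : ltv L :=
  \A q : cond P, dom P q ==>> below P q p ==>> a q.

Definition dense_below (p : cond P) (a : cond P -> ltv L) : ltv L :=
  all_below p (fun q =>
    \E r : cond P, dom P r &&& below P r q &&& a r).

(* The truth value [a] of the extension is the map sending [p] to the truth
   value, in [L], of "[p] forces [a]"; the fields of [extension] are thus the
   clauses of the forcing relation. A name for a subset of [T] is, in [L], a set
   of pairs (t, r) with t in T and r a condition, and [p] forces t to belong to
   it when the set of q that are below such an r is dense below [p]. *)
Definition extension : logic :=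
  {| ltv := cond P -> ltv L;
     lname := cond P -> lname L;
     lval := fun A p => dense_below p (fun q =>
       \E r : cond P, dom P r &&& below P q r &&& lval (A r));
     lprop := fun Q _ => lprop Q;
     land := fun a b p => a p &&& b p;
     limp := fun a b p => all_below p (fun q => a q ==>> b q);
     lall := fun T a p => \A x : T, a x p;
     lex := fun T a p => dense_below p (fun q => \E x : T, a x q) |}.

Definition forces (p : cond P) (a : ltv extension) : ltv L := a p.

Definition forced (a : ltv extension) : ltv L :=
  \A p : cond P, dom P p ==>> forces p a.

End Extension.

(** * Mathias forcing and B-Canjar filters, in an arbitrary universe *)

Section Canjar.
Variable L : logic.
Local Open Scope logic_scope.

Definition lset (T : Type) := T -> lname L.
Definition lin (T : Type) (x : T) (A : lset T) : ltv L := lval (A x).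
Definition lsub (T : Type) (A B : lset T) : ltv L :=
  \A x : T, lin x A ==>> lin x B.

(* A family of subsets of omega *)
Definition lfamily := lset nat -> ltv L.

(* A function from omega to omega is a set of pairs. *)
Definition lfunction (g : lset (nat * nat)) : ltv L :=
  (\A n : nat, \E m : nat, lin (n, m) g) &&&
  (\A n : nat, \A m : nat, \A m' : nat,
     lin (n, m) g ==>> lin (n, m') g ==>> lprop (m = m')).

Definition lle_star (f : nat -> nat) (g : lset (nat * nat)) : ltv L :=
  \E k : nat, \A n : nat, lprop (k <= n)%N ==>>
    \A m : nat, lin (n, m) g ==>> lprop (f n <= m)%N.

(* The family [B] of functions of the base universe is unbounded in [L]. *)
Definition lunbounded (B : set (nat -> nat)) : ltv L :=
  lneg (\E g : lset (nat * nat),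
    lfunction g &&& \A f : nat -> nat, lprop (B f) ==>> lle_star f g).

(* The filter generated in [L] by the filter [F] of the base universe *)
Definition generated (F : set_system nat) : lfamily := fun A =>
  \E X : set nat, lprop (F X) &&& \A n : nat, lprop (X n) ==>> lin n A.

Definition mathias (F : lfamily) : forcing L :=
  {| cond := seq bool * lset nat;
     dom := fun p => F p.2;
     below := fun q p =>
       lprop (prefix p.1 q.1) &&& lsub q.2 p.2 &&&
       \A n : nat, lprop (size p.1 <= n < size q.1)%N ==>>
         lprop (nth false q.1 n) ==>> lin n p.2 |}.

End Canjar.

Arguments generated L F : clear implicits.
Arguments mathias L F : clear implicits.

Definition Canjar (L : logic) (B : set (nat -> nat)) (F : lfamily L) : ltv L :=
  forced (P := mathias L F) (lunbounded (extension (mathias L F)) B).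

Arguments Canjar L B F : clear implicits.

Lemma lunbounded_ground (B : set (nat -> nat)) :
  lunbounded ground B <-> unbounded B.
Proof.
split=> unbB [g].
  move=> gB; apply: unbB; exists (fun nm => g nm.1 = nm.2); split.
    split=> [n|n m m']; first by exists (g n).
    by rewrite /lin /= => <-.
  move=> f /gB [k _ fg]; exists k => n kn m; rewrite /lin /= => <-.
  exact: fg.
move=> [[gtot gfun] gB]; apply: unbB.
have [h hP] := choice gtot.
by exists h => f /gB [k fg]; exists k => // n kn; apply: fg (hP n).
Qed.

(* Main.v *)
(* Splitting a condition of M(F0 (+) F1) into its even and odd halves embeds
   M(F0 (+) F1) densely into the iteration of M(F1) and M(F0): a condition of M(F1)
   can be strengthened so as to decide a set of F0 contained in the second
   coordinate of the name of a condition of M(F0), and a pair of conditions with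
   ground model sets becomes a condition of the sum once the shorter stem is padded
   with zeros. A name in the iteration for a function dominating B can therefore be
   pulled back to a name in the extension by M(F0 (+) F1), where B stays unbounded. *)

Require Import Defs.
From mathcomp Require Import all_boot.
From mathcomp Require Import all_classical.

Set Implicit Arguments.
Unset Strict Implicit.
Unset Printing Implicit Defensive.

Local Open Scope classical_set_scope.

(** * Monotonicity of the forcing relation *)

Section Persistence.
Context {P : forcing ground}.

(** Truth values of [extension P] are arbitrary maps on conditions, so it is not built in that
    stronger conditions force more. Clauses that quantify over all stronger conditions get it from
    transitivity alone. *)
Definition persistent (a : ltv (extension P)) : Prop :=
  forall p p' : cond P, dom P p' -> below P p' p -> a p -> a p'.

Hypothesis below_refl : forall p : cond P, below P p p.
Hypothesis below_trans : forall p q r : cond P,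
  below P p q -> below P q r -> below P p r.

Lemma persistent_land (a b : ltv (extension P)) :
  persistent a -> persistent b -> persistent (land a b).
Proof.
move=> a_per b_per p p' p'dom p'p [ap bp].
by split; [exact: a_per ap | exact: b_per bp].
Qed.

Lemma persistent_limp (a b : ltv (extension P)) : persistent (limp a b).
Proof.
move=> p p' p'dom p'p ab q qdom qp'.
exact: ab qdom (below_trans qp' p'p).
Qed.

Lemma persistent_lall (T : Type) (a : T -> ltv (extension P)) :
  (forall x, persistent (a x)) -> persistent (lall T a).
Proof. by move=> a_per p p' p'dom p'p ap x; exact: a_per (ap x). Qed.

Lemma persistent_lex (T : Type) (a : T -> ltv (extension P)) :
  persistent (lex T a).
Proof.
move=> p p' p'dom p'p ap q qdom qp'.
exact: ap qdom (below_trans qp' p'p).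
Qed.

Lemma persistent_lval (A : lname (extension P)) : persistent (lval A).
Proof.
move=> p p' p'dom p'p ap q qdom qp'.
exact: ap qdom (below_trans qp' p'p).
Qed.

Lemma lval_cst (X : Prop) (p : cond P) :
  dom P p -> lval (l := extension P) (fun=> X) p <-> X.
Proof.
move=> pdom; split=> [Xp|x q qdom qp].
  by have [r [_ [s [_ x]]]] := Xp p pdom (below_refl p).
by exists q; split=> //; exists q.
Qed.

End Persistence.

(** * Two-step iterations and pulling names back along a dense map *)

Section Transfer.
Variables (P : forcing ground) (Q : forcing (extension P)) (R : forcing ground).

Hypothesis below_reflP : forall p : cond P, below P p p.
Hypothesis below_transP : forall p q r : cond P,
  below P p q -> below P q r -> below P p r.
Hypothesis persistent_domQ : forall q : cond Q, persistent (dom Q q).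
Hypothesis persistent_belowQ :
  forall q' q : cond Q, persistent (below Q q' q).
Hypothesis below_reflQ : forall (q : cond Q) (p : cond P),
  dom P p -> below Q q q p.
Hypothesis below_transQ : forall (q r s : cond Q) (p : cond P),
  dom P p -> below Q q r p -> below Q r s p -> below Q q s p.

(** The order of the two-step iteration of [P] and [Q]. Only the stronger pair is required to be a
    condition. *)
Definition below_iter (q' : cond Q) (p' : cond P) (q : cond Q) (p : cond P) :=
  [/\ dom P p', dom Q q' p', below P p' p & below Q q' q p'].

Lemma below_iter_refl (q : cond Q) (p : cond P) :
  dom P p -> dom Q q p -> below_iter q p q p.
Proof. by move=> pdom qdom; split=> //; exact: below_reflQ. Qed.

Lemma below_iter_trans (q r s : cond Q) (p p' p'' : cond P) :
  below_iter q p r p' -> below_iter r p' s p'' -> below_iter q p s p''.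
Proof.
move=> [pdom qdom pp' qr] [p'dom rdom p'p'' rs]; split=> //.
  exact: below_transP pp' p'p''.
by apply: below_transQ qr _ => //; exact: persistent_belowQ rs.
Qed.

Lemma dense_belowQ (a : cond Q -> ltv (extension P))
    (q q' : cond Q) (p p' : cond P) :
    dense_below q a p -> below_iter q' p' q p ->
  exists q'' p'', below_iter q'' p'' q' p' /\ a q'' p''.
Proof.
move=> qa [p'dom q'dom p'p q'q].
(* Each connective is read in the extension by [P] and so ranges over conditions of [P]: the first
   is taken at [p'], the later ones at [p'] again by reflexivity. *)
have [p'' [[p''dom p''p'] [q'' [[q''dom q''q'] aq'']]]] :=
  qa q' p' p'dom p'p q'dom p' p'dom (below_reflP p') q'q
     p' p'dom (below_reflP p').
by exists q'', p''.
Qed.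

(** The [P] coordinate is strengthened twice: once for density in [Q], once to decide the witness,
    whose existence is itself only forced by [P]. *)
Lemma lexQ (T : Type) (a : T -> ltv (extension Q))
    (q q' : cond Q) (p p' : cond P) :
    lex (l := extension Q) T a q p -> below_iter q' p' q p ->
  exists q'' p'' x, below_iter q'' p'' q' p' /\ a x q'' p''.
Proof.
move=> aq /(dense_belowQ aq) [r [s [rs ars]]].
have [sdom rdom _ _] := rs.
have [s' [[s'dom s's] [x axs']]] := ars s sdom (below_reflP s).
exists r, s', x; split=> //; apply: below_iter_trans rs; split=> //.
  exact: persistent_domQ rdom.
exact: below_reflQ.
Qed.

Lemma limpQ (a b : ltv (extension Q)) (q q' : cond Q) (p p' : cond P) :
    limp a b q p -> below_iter q' p' q p -> a q' p' -> b q' p'.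
Proof.
move=> ab [p'dom q'dom p'p q'q].
exact: (ab q' p' p'dom p'p q'dom p' p'dom (below_reflP p') q'q
  p' p'dom (below_reflP p')).
Qed.

Lemma lvalQ_below (A : lname (extension Q)) (q q' : cond Q) (p p' : cond P) :
  below_iter q' p' q p -> lval A q p -> lval A q' p'.
Proof.
move=> [p'dom q'dom p'p q'q] Aqp.
move=> r s sdom sp' rdom t tdom ts rq'.
apply: (Aqp r t tdom _ _ t tdom (below_reflP t)).
- exact: below_transP ts (below_transP sp' p'p).
- exact: persistent_domQ rdom.
- apply: below_transQ rq' _ => //.
  exact: persistent_belowQ (below_transP ts sp') q'q.
Qed.

Variables (eQ : cond R -> cond Q) (eP : cond R -> cond P).

Hypothesis below_reflR : forall r : cond R, below R r r.
Hypothesis below_transR : forall p q r : cond R,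
  below R p q -> below R q r -> below R p r.
Hypothesis e_below : forall r' r : cond R, dom R r' -> below R r' r ->
  below_iter (eQ r') (eP r') (eQ r) (eP r).
Hypothesis e_dense : forall (q : cond Q) (p : cond P),
  dom P p -> dom Q q p ->
  exists r : cond R, dom R r /\ below_iter (eQ r) (eP r) q p.
(** Density alone would give no [r'] below [r]. The lifting is what lets a strengthening made in the
    iteration be followed inside [R]. *)
Hypothesis e_lift : forall (q : cond Q) (p : cond P) (r : cond R),
  dom R r -> below_iter q p (eQ r) (eP r) ->
  exists r' : cond R,
    [/\ dom R r', below R r' r & below_iter (eQ r') (eP r') q p].

(** Over the ground universe any relation between elements and conditions is a name, so the forcing
    relation of the iteration can itself serve as one. *)
Definition pullback {T : Type} (A : lset (extension Q) T) :
    lset (extension R) T :=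
  fun x r => lin x A (eQ r) (eP r).

(** Membership is recovered only at a stronger condition. This suffices below, where the conclusions
    drawn from it are absolute facts about numbers. *)
Lemma lin_pullback (T : Type) (x : T) (A : lset (extension Q) T) (r : cond R) :
    dom R r -> lin x (pullback A) r ->
  exists r', [/\ dom R r', below R r' r & lin x A (eQ r') (eP r')].
Proof.
move=> rdom /(_ r rdom (below_reflR r)) [r' [[r'dom r'r] [s [[sdom r's] xs]]]].
exists r'; split=> //; exact: lvalQ_below (e_below r'dom r's) xs.
Qed.

Lemma pullback_lin (T : Type) (x : T) (A : lset (extension Q) T) (r : cond R) :
    lin x A (eQ r) (eP r) -> lin x (pullback A) r.
Proof.
move=> xr r' r'dom r'r; exists r'; split; first by split.
exists r'; split; first by split.
exact: lvalQ_below (e_below r'dom r'r) xr.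
Qed.

Lemma lin_pullback_below (T : Type) (x : T) (A : lset (extension Q) T)
    (r r' : cond R) : dom R r' -> below R r' r ->
  lin x (pullback A) r -> lin x (pullback A) r'.
Proof. exact: persistent_lval. Qed.

(** A witness is found at a pair below the image of a given [r'], and [e_lift] brings that pair back
    to some [s] below [r']. *)
Lemma lexR (T : Type) (a : T -> ltv (extension Q)) (a' : T -> ltv (extension R))
    (q : cond Q) (p : cond P) (r : cond R) :
    (forall x s q' p', dom R s -> below_iter (eQ s) (eP s) q' p' ->
       below_iter q' p' q p -> a x q' p' -> a' x s) ->
    lex (l := extension Q) T a q p -> below_iter (eQ r) (eP r) q p ->
  lex (l := extension R) T a' r.
Proof.
move=> aa' aqp rqp r' r'dom r'r.
have r'qp := below_iter_trans (e_below r'dom r'r) rqp.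
have [q' [p' [x [q'p'r' aq'p']]]] := lexQ aqp r'qp.
have [s [sdom sr' sq'p']] := e_lift r'dom q'p'r'.
exists s; split; first by split.
exists x; apply: aa' aq'p' => //; exact: below_iter_trans q'p'r' r'qp.
Qed.

Lemma lfunction_pullback (g : lset (extension Q) (nat * nat))
    (q : cond Q) (p : cond P) (r : cond R) :
    lfunction g q p -> below_iter (eQ r) (eP r) q p ->
  lfunction (pullback g) r.
Proof.
move=> [gtot gfun] rqp; split=> [n|n m m' r1 r1dom r1r gm r2 r2dom r21 gm'].
  apply: lexR (gtot n) rqp => m s q' p' sdom sq'p' _ gm.
  by apply: pullback_lin; exact: lvalQ_below gm.
(* The two memberships are settled in turn: the first one is carried down to [r3] before [r4] is
   chosen, and [m = m'] does not depend on the condition. *)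
have [r3 [r3dom r32 {}gm']] := lin_pullback r2dom gm'.
have r31 := below_transR r32 r21.
have [r4 [r4dom r43 {}gm]] :=
  lin_pullback r3dom (lin_pullback_below r3dom r31 gm).
have r4r := below_transR r43 (below_transR r31 r1r).
have r4qp := below_iter_trans (e_below r4dom r4r) rqp.
have r44 := e_below r4dom (below_reflR r4).
apply: limpQ (limpQ (gfun n m m') r4qp gm) r44 _.
exact: lvalQ_below (e_below r4dom r43) gm'.
Qed.

Lemma lle_star_pullback (f : nat -> nat) (g : lset (extension Q) (nat * nat))
    (q : cond Q) (p : cond P) (r : cond R) :
    lle_star f g q p -> below_iter (eQ r) (eP r) q p ->
  lle_star f (pullback g) r.
Proof.
apply: lexR => k s q' p' sdom sq'p' _ fg n r1 r1dom r1s kn.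
move=> m r2 r2dom r21 gm.
have [r3 [r3dom r32 {}gm]] := lin_pullback r2dom gm.
have r3s := below_transR r32 (below_transR r21 r1s).
have r3q'p' := below_iter_trans (e_below r3dom r3s) sq'p'.
have r33 := e_below r3dom (below_reflR r3).
exact: (limpQ (limpQ (fg n) r3q'p' kn m) r33 gm).
Qed.

Lemma lunbounded_pullback (B : set (nat -> nat)) :
    forced (lunbounded (extension R) B) ->
  forall p, dom P p -> forced (lunbounded (extension Q) B) p.
Proof.
move=> unbR p0 p0dom q0 p1 p1dom p10 q0dom.
(* Every implication lowers the [P] coordinate; at the last one, [p], the pair [(q1, p)] is assumed
   to force a bound for [B], and [False] is to be derived. *)
move=> q1 p2 p2dom p21 q1dom p3 p3dom p32 q10 p p_dom pp3 gqp.
have qdom : dom Q q1 p.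
  exact: persistent_domQ (below_transP pp3 p32) q1dom.
have [q [p' [g [qp' [gfun gB]]]]] := lexQ gqp (below_iter_refl p_dom qdom).
have [p'dom q'dom _ _] := qp'.
have [r [rdom rqp]] := e_dense p'dom q'dom.
apply: (unbR r rdom r rdom (below_reflR r)) => r1 r1dom r1r.
(* No further strengthening is needed: [pullback g] is forced to be a bound by every condition below
   [r]. *)
exists r1; split; first by split=> //; exact: below_reflR.
have r1qp := below_iter_trans (e_below r1dom r1r) rqp.
exists (pullback g); split; first exact: lfunction_pullback gfun r1qp.
move=> f r2 r2dom r21 Bf.
have r2qp := below_iter_trans (e_below r2dom r21) r1qp.
apply: lle_star_pullback r2qp.
exact: limpQ (gB f) (below_iter_refl p'dom q'dom) Bf.
Qed.

End Transfer.

(** * Mathias forcing in the ground universe *)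

Lemma nth_prefix (s t : bitseq) (n : nat) :
  prefix s t -> n < size s -> nth false t n = nth false s n.
Proof. by move=> /prefixP [u ->] ns; rewrite nth_cat ns. Qed.

Lemma prefix_nth (s t : bitseq) :
    size s <= size t ->
    (forall n, n < size s -> nth false t n = nth false s n) ->
  prefix s t.
Proof.
move=> st eq_st; rewrite prefixE; apply/eqP/(@eq_from_nth _ false).
  by rewrite size_takel.
by move=> n; rewrite size_takel // => ns; rewrite nth_take // eq_st.
Qed.

Lemma nth_true_size (s : bitseq) (n : nat) : nth false s n -> n < size s.
Proof. by case: ltnP => // /(nth_default false) ->. Qed.

Section MathiasGround.
Variable F : lfamily ground.

(** The upper bound on [n] is automatic, because [nth] returns the default [false] past the end of
    the stem. *)
Lemma below_mathias (q p : cond (mathias ground F)) :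
  below (mathias ground F) q p <->
  [/\ prefix p.1 q.1, q.2 `<=` p.2 &
      forall n, size p.1 <= n -> nth false q.1 n -> p.2 n].
Proof.
split=> [[[pq sub] pqn]|[pq sub pqn]]; split=> // n.
- by move=> pn qn; apply: (pqn n) => //; rewrite /= pn nth_true_size.
- by move=> /andP [pn _]; exact: pqn.
Qed.

Lemma below_mathias_refl (p : cond (mathias ground F)) :
  below (mathias ground F) p p.
Proof.
apply/below_mathias; split=> // [|n pn /nth_true_size]; first exact: prefix_refl.
by rewrite ltnNge pn.
Qed.

Lemma below_mathias_trans (p q r : cond (mathias ground F)) :
  below (mathias ground F) p q -> below (mathias ground F) q r ->
  below (mathias ground F) p r.
Proof.
move=> /below_mathias [qp subq pqn] /below_mathias [rq subr qrn].
apply/below_mathias; split; first exact: prefix_trans rq qp.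
  exact: subset_trans subq subr.
move=> n rn pn; have [qn|nq] := leqP (size q.1) n; first exact/subr/pqn.
by apply: qrn => //; rewrite -(nth_prefix qp nq).
Qed.

End MathiasGround.

(** * Mathias forcing in an extension *)

Section MathiasExtension.
Variable P : forcing ground.
Hypothesis below_refl : forall p : cond P, below P p p.
Hypothesis below_trans : forall p q r : cond P,
  below P p q -> below P q r -> below P p r.
Variable F : set_system nat.

Let Q := mathias (extension P) (generated (extension P) F).

Lemma persistent_lin (T : Type) (x : T) (A : lset (extension P) T) :
  persistent (lin x A).
Proof. exact: persistent_lval. Qed.

Lemma persistent_dom_mathias (q : cond Q) : persistent (dom Q q).
Proof. exact: persistent_lex. Qed.

Lemma persistent_lsub (A A' : lset (extension P) nat) : persistent (lsub A A').
Proof. by apply: persistent_lall => n; exact: persistent_limp. Qed.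

Lemma persistent_below_mathias (q' q : cond Q) : persistent (below Q q' q).
Proof.
apply: persistent_land; last by apply: persistent_lall => n; exact: persistent_limp.
by apply: persistent_land; [move=> ? | exact: persistent_lsub].
Qed.

(** The stems are ground model objects, so the premises about them hold at all conditions or at
    none, and monotonicity removes the quantifiers over stronger conditions. *)
Lemma below_mathias_ext (q' q : cond Q) (p : cond P) : dom P p ->
  below Q q' q p <->
  [/\ prefix q.1 q'.1, lsub q'.2 q.2 p &
      forall n, size q.1 <= n -> nth false q'.1 n -> lin n q.2 p].
Proof.
move=> pdom; split=> [[[qq' sub] qn]|[qq' sub qn]]; split=> // n.
- move=> n_ge q'n; have n_lt := nth_true_size q'n.
  apply: (qn n p pdom (below_refl p) _ p pdom (below_refl p) q'n).
  by rewrite /= n_ge n_lt.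
- move=> p' p'dom p'p /andP [n_ge _] p'' p''dom p''p' q'n.
  by apply: persistent_lin (qn n n_ge q'n) => //; exact: below_trans p''p' p'p.
Qed.

Lemma below_mathias_ext_refl (q : cond Q) (p : cond P) :
  dom P p -> below Q q q p.
Proof.
move=> pdom; apply/below_mathias_ext => //; split; first exact: prefix_refl.
  by move=> n p' _ _.
by move=> n n_ge /nth_true_size; rewrite ltnNge n_ge.
Qed.

Lemma below_mathias_ext_trans (q r s : cond Q) (p : cond P) : dom P p ->
  below Q q r p -> below Q r s p -> below Q q s p.
Proof.
move=> pdom /(below_mathias_ext _ _ pdom) [rq subr qrn].
move=> /(below_mathias_ext _ _ pdom) [sr subs rsn].
apply/below_mathias_ext => //; split; first exact: prefix_trans sr rq.
  by move=> n p' p'dom p'p qn; apply: (subs n) => //; exact: (subr n).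
move=> n n_ge qn; have [rn|nr] := leqP (size r.1) n.
  exact: (subs n p pdom (below_refl p) (qrn n rn qn)).
by apply: rsn => //; rewrite -(nth_prefix rq nr).
Qed.

Definition check (X : set nat) : lset (extension P) nat := fun n _ => X n.

Lemma dom_check (s : bitseq) (X : set nat) (p : cond P) :
  F X -> dom Q (s, check X) p.
Proof.
move=> FX p' p'dom p'p; exists p'; split; first by split.
exists X; split=> // n p'' p''dom _ Xn; exact/lval_cst.
Qed.

(** A set of the generated filter contains some ground model set of [F]; a stronger condition
    decides which one. *)
Lemma dom_mathias_ext (q : cond Q) (p : cond P) : dom P p -> dom Q q p ->
  exists X p', [/\ F X, dom P p', below P p' p &
                forall n, X n -> lin n q.2 p'].
Proof.
move=> pdom /(_ p pdom (below_refl p)) [p' [[p'dom p'p] [X [FX Xq]]]].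
exists X, p'; split=> // n; exact: (Xq n p' p'dom (below_refl p')).
Qed.

End MathiasExtension.

(** * Splitting and interleaving stems *)

Definition evens (u : bitseq) : bitseq :=
  mkseq (fun n => nth false u n.*2) (uphalf (size u)).

Definition odds (u : bitseq) : bitseq :=
  mkseq (fun n => nth false u n.*2.+1) (size u)./2.

(* The shorter of the two sequences is padded with zeros. *)
Definition interleave (s t : bitseq) : bitseq :=
  mkseq (fun n => nth false (if odd n then t else s) n./2)
    (maxn (size s) (size t)).*2.

Lemma nth_evens (u : bitseq) (n : nat) :
  nth false (evens u) n = nth false u n.*2.
Proof.
have [n_lt|n_ge] := ltnP n (uphalf (size u)); first by rewrite nth_mkseq.
by rewrite !nth_default ?size_mkseq // -leq_uphalf_double.
Qed.

Lemma nth_odds (u : bitseq) (n : nat) :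
  nth false (odds u) n = nth false u n.*2.+1.
Proof.
have [n_lt|n_ge] := ltnP n (size u)./2; first by rewrite nth_mkseq.
by rewrite !nth_default ?size_mkseq // -leq_half_double.
Qed.

Lemma nth_interleave (s t : bitseq) (n : nat) :
  nth false (interleave s t) n = nth false (if odd n then t else s) n./2.
Proof.
have [n_lt|n_ge] := ltnP n (maxn (size s) (size t)).*2.
  by rewrite nth_mkseq.
(* Here [n./2] lies past the end of both sequences, so both sides are the default [false]. *)
rewrite !nth_default ?size_mkseq //.
have : maxn (size s) (size t) <= n./2 by rewrite geq_half_double.
by rewrite geq_max => /andP []; case: ifP.
Qed.

Lemma evens_interleave (s t : bitseq) (n : nat) :
  nth false (evens (interleave s t)) n = nth false s n.
Proof. by rewrite nth_evens nth_interleave odd_double doubleK. Qed.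

Lemma odds_interleave (s t : bitseq) (n : nat) :
  nth false (odds (interleave s t)) n = nth false t n.
Proof. by rewrite nth_odds nth_interleave /= odd_double /= uphalf_double. Qed.

Lemma prefix_evens_interleave (s t : bitseq) :
  prefix s (evens (interleave s t)).
Proof.
apply: prefix_nth => [|n _]; last exact: evens_interleave.
by rewrite !size_mkseq uphalf_double leq_maxl.
Qed.

Lemma prefix_odds_interleave (s t : bitseq) :
  prefix t (odds (interleave s t)).
Proof.
apply: prefix_nth => [|n _]; last exact: odds_interleave.
by rewrite !size_mkseq doubleK leq_maxr.
Qed.

Lemma prefix_evens (u v : bitseq) : prefix u v -> prefix (evens u) (evens v).
Proof.
move=> uv; apply: prefix_nth => [|n].
  by rewrite !size_mkseq !uphalfE half_leq // ltnS size_prefix.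
rewrite size_mkseq !nth_evens gtn_uphalf_double; exact: nth_prefix.
Qed.

Lemma prefix_odds (u v : bitseq) : prefix u v -> prefix (odds u) (odds v).
Proof.
move=> uv; apply: prefix_nth => [|n].
  by rewrite !size_mkseq half_leq // size_prefix.
rewrite size_mkseq !nth_odds gtn_half_double; exact: nth_prefix.
Qed.

Lemma prefix_interleave (u s t : bitseq) :
  prefix (evens u) s -> prefix (odds u) t -> prefix u (interleave s t).
Proof.
move=> us ut; apply: prefix_nth => [|n nu].
  (* The even half is the one rounded up, so the length of [s] alone already bounds that of [u]. *)
  rewrite size_mkseq -leq_uphalf_double leq_max.
  by have := size_prefix us; rewrite size_mkseq => ->.
rewrite nth_interleave; case: ifPn => n_odd.
  rewrite (nth_prefix ut) ?nth_odds ?odd_halfK //.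
    by case: n n_odd {nu}.
  rewrite size_mkseq gtn_half_double; case: n n_odd nu => //= n n_even.
  by rewrite uphalf_half (negbTE n_even) even_halfK.
rewrite (nth_prefix us) ?nth_evens ?even_halfK //.
by rewrite size_mkseq gtn_uphalf_double even_halfK.
Qed.

Lemma osum_double (A C : set nat) (n : nat) : osum A C n.*2 <-> A n.
Proof.
split=> [[[m Am /double_inj <-] //|[m _ /(congr1 odd)]]|An].
  by rewrite /= !odd_double.
by left; exists n.
Qed.

Lemma osum_doubleS (A C : set nat) (n : nat) : osum A C n.*2.+1 <-> C n.
Proof.
split=> [[[m _ /(congr1 odd)]|[m Cm [/double_inj <-]] //]|Cn].
  by rewrite /= !odd_double.
by right; exists n.
Qed.

Lemma osum_subset (A A' C C' : set nat) :
  A `<=` A' -> C `<=` C' -> osum A C `<=` osum A' C'.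
Proof. by move=> AA' CC' n [[m /AA' ? <-]|[m /CC' ? <-]]; [left|right]; exists m. Qed.

(** * The dense map from the sum forcing to the iteration *)

Section MathiasSum.
Variables (F0 F1 : set_system nat).
Hypotheses (F0_filter : Filter F0) (F1_filter : Filter F1).

Let P := mathias ground F1.
Let Q := mathias (extension P) (generated (extension P) F0).
Let R := mathias ground (filter_osum F0 F1).

(** Taking preimages instead of choosing summands keeps both parts defined on all of [cond R],
    including pairs outside the domain. *)
Definition even_part (r : cond R) : cond Q :=
  (evens r.1, check (P := P) [set n | r.2 n.*2]).

Definition odd_part (r : cond R) : cond P :=
  (odds r.1, [set n | r.2 n.*2.+1]).

Lemma dom_even_part (r : cond R) (p : cond P) :
  dom R r -> dom Q (even_part r) p.
Proof.
move=> [A FA [C FC Er]]; apply: (dom_check (below_mathias_refl (F := F1))).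
by apply: filterS FA => n An; rewrite /= -Er; apply/osum_double.
Qed.

Lemma dom_odd_part (r : cond R) : dom R r -> dom P (odd_part r).
Proof.
move=> [A FA [C FC Er]].
by rewrite /=; apply: filterS FC => n Cn; rewrite /= -Er; apply/osum_doubleS.
Qed.

(** The rounding of the halves fits: [n] is past the end of the even half iff [n.*2] is past the end
    of the stem, and likewise with [n.*2.+1] for the odd half. *)
Lemma below_iter_parts (r' r : cond R) : dom R r' -> below R r' r ->
  below_iter (even_part r') (odd_part r') (even_part r) (odd_part r).
Proof.
move=> r'dom /below_mathias [rr' sub rn].
have odom := dom_odd_part r'dom.
split=> //; first exact: dom_even_part.
  apply/below_mathias; split=> /=; first exact: prefix_odds.
    by move=> n; exact: sub.
  move=> n; rewrite size_mkseq nth_odds leq_half_double; exact: rn.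
apply/(below_mathias_ext (below_mathias_refl (F := F1))
  (@below_mathias_trans F1)) => //; split=> /=; first exact: prefix_evens.
  move=> n p pdom _ /(lval_cst (below_mathias_refl (F := F1)) _ pdom) r'n.
  by apply/(lval_cst (below_mathias_refl (F := F1)) _ pdom); exact: sub.
move=> n; rewrite size_mkseq nth_evens leq_uphalf_double => n_ge r'n.
by apply/(lval_cst (below_mathias_refl (F := F1)) _ odom); exact: rn.
Qed.

Lemma parts_lift (q : cond Q) (p : cond P) (r : cond R) :
    dom R r -> below_iter q p (even_part r) (odd_part r) ->
  exists r' : cond R, [/\ dom R r', below R r' r &
    below_iter (even_part r') (odd_part r') q p].
Proof.
have refl1 := below_mathias_refl (F := F1).
have trans1 := @below_mathias_trans F1.
move=> [A FA [C FC Er]] [pdom qdom pr qr].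
(* [q.2] is only a name, so [p] is first strengthened to decide a set [X] of [F0] inside it. *)
have [X [p' [FX p'dom p'p Xq]]] := dom_mathias_ext refl1 pdom qdom.
have p'r := trans1 _ _ _ p'p pr.
move/below_mathias: (p'p) => [pp' subp pn].
move/below_mathias: (p'r) => /= [rp' subr rn].
move/(below_mathias_ext refl1 trans1 _ _ pdom): qr => /= [rq _ rqn].
(* [A] keeps the even half below that of [r], and [X] keeps it below [q]; [p'.2] already lies in the
   odd half of [r.2]. *)
pose r' : cond R := (interleave q.1 p'.1, osum (A `&` X) p'.2).
have r'dom : dom R r' by exists (A `&` X); [exact: filterI|exists p'.2].
have odom := dom_odd_part r'dom.
have op' : below P (odd_part r') p'.
  apply/below_mathias; split=> /=; first exact: prefix_odds_interleave.
    by move=> n /osum_doubleS.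
  (* Beyond the stem of [p'] there are only padding zeros, which put no demand on [p'.2]. *)
  by move=> n n_ge; rewrite odds_interleave nth_default.
exists r'; split=> //.
  apply/below_mathias; split=> /=; first exact: prefix_interleave.
    rewrite -Er; apply: osum_subset => [n []|n /subr] //=.
    by rewrite -Er => /osum_doubleS.
  (* New ones at odd places come from [p'.1] and at even places from [q.1]. For the latter [p]
     forces membership in a check name, which is a ground fact. *)
  move=> n n_ge; rewrite nth_interleave; case: ifPn => n_odd.
    move=> /rn /=; rewrite size_mkseq odd_halfK //.
    case: n n_odd n_ge => //= n n_even n_ge; apply.
    by rewrite leq_half_double uphalf_half (negbTE n_even) even_halfK.
  move=> /rqn; rewrite size_mkseq leq_uphalf_double even_halfK // => /(_ n_ge).
  by move/(lval_cst refl1 _ pdom); rewrite /= even_halfK.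
split=> //; first exact: dom_even_part.
  exact: trans1 op' p'p.
apply/(below_mathias_ext refl1 trans1) => //; split=> /=.
- exact: prefix_evens_interleave.
(* [Xq] speaks of [p']; it passes to [s], which is below [p'] via the odd part of [r']. *)
- move=> n s sdom so /(lval_cst refl1 _ sdom) /osum_double [_ /Xq Xn].
  exact: (persistent_lin trans1 sdom (trans1 s (odd_part r') p' so op') Xn).
- by move=> n n_ge; rewrite evens_interleave nth_default.
Qed.

(** This is [parts_lift] at the weakest condition of the sum, whose two parts lie above every
    pair. *)
Lemma parts_dense (q : cond Q) (p : cond P) : dom P p -> dom Q q p ->
  exists r : cond R, dom R r /\ below_iter (even_part r) (odd_part r) q p.
Proof.
have refl1 := below_mathias_refl (F := F1).
have trans1 := @below_mathias_trans F1.
move=> pdom qdom.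
have top_dom : dom R ([::], osum setT setT).
  by exists setT; [exact: filterT|exists setT => //; exact: filterT].
have [|r [rdom _ rqp]] := parts_lift (q := q) (p := p) top_dom; last by exists r.
split=> //.
  apply/below_mathias; split=> [|n _|n _ _]; first exact: prefix0s.
    exact/osum_doubleS.
  exact/osum_doubleS.
apply/(below_mathias_ext refl1 trans1) => //; split; first exact: prefix0s.
  move=> n s sdom _ _; apply/(lval_cst refl1) => //; exact/osum_double.
by move=> n _ _; apply/(lval_cst refl1) => //; exact/osum_double.
Qed.

End MathiasSum.

Unset Implicit Arguments.

Theorem proposition1p3 (F0 F1 : set_system nat) (B : set (nat -> nat))
    (F0_proper : ProperFilter F0) (F0_Frechet : \oo `<=` F0)
    (F1_proper : ProperFilter F1) (F1_Frechet : \oo `<=` F1)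
    (B_unbounded : unbounded B) :
  Canjar ground B (filter_osum F0 F1) ->
  forced (P := mathias ground F1)
    (Canjar (extension (mathias ground F1)) B
       (generated (extension (mathias ground F1)) F0)).
Proof.
have refl1 := @below_mathias_refl F1; have trans1 := @below_mathias_trans F1.
(* Both Canjar statements unfold to [forced] applied to [lunbounded], and the last three arguments
   determine the map as [even_part] and [odd_part]. *)
exact: (lunbounded_pullback refl1 trans1
  (persistent_dom_mathias trans1 (F := F0))
  (persistent_below_mathias trans1 (F := F0))
  (below_mathias_ext_refl refl1 trans1 (F := F0))
  (below_mathias_ext_trans refl1 trans1 (F := F0))
  (@below_mathias_refl _) (@below_mathias_trans _)
  (below_iter_parts _ _) (parts_dense _ _) (parts_lift _ _)).
Qed.
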